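(* Let $T_\omega(n)$ be as defined in the context and let $\omega(q)=\sum_{n\ge0}\frac{q^{2n^2+2n}}{(q;q^2)_{n+1}^2}$. Then, as formal power series (equivalently for $|q|<1$), $$\sum_{n\ge1}T_\omega(n)q^n=q\,\omega(q).$$
   Context: $(a;q)_n=\prod_{j=0}^{n-1}(1-aq^j)$, $(a;q)_\infty=\prod_{j\ge0}(1-aq^j)$. A two-color partition is a partition whose parts are each colored blue or green (the same integer may occur in both colors). $T_\omega(n)$ is the signed count of two-color partitions of $n$ such that: all even parts are blue and the even parts are distinct; the smallest part $s$ is odd and occurs at least once in blue; (all green parts are odd; odd parts of either color may repeat). Each such partition is counted with weight $(-1)^j$, where $j$ is the number of even parts. Equivalently, $\sum_{n\ge1}T_\omega(n)q^n=\sum_{n\ge0}\frac{q^{2n+1}(q^{2n+2};q^2)_\infty}{(q^{2n+1};q^2)_\infty^2}$. *)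

(* Defs.v *)
From HB Require Import structures.
From mathcomp Require Import all_boot all_order all_algebra.
From mathcomp Require Import boolp classical_sets.

Set Implicit Arguments.
Unset Strict Implicit.
Unset Printing Implicit Defensive.

Import Order.TTheory GRing.Theory Num.Theory.

Local Open Scope ring_scope.

(** * Formal power series over the integers *)

Record fps := Fps { fcoef : nat -> int }.

HB.instance Definition _ := gen_eqMixin fps.
HB.instance Definition _ := gen_choiceMixin fps.

Lemma fpsP (f g : fps) : (forall n, fcoef f n = fcoef g n) -> f = g.
Proof. by case: f g => [f] [g] /= fg; congr Fps; apply: funext. Qed.

Definition fps_add (f g : fps) := Fps (fun n => fcoef f n + fcoef g n).
Definition fps_opp (f : fps) := Fps (fun n => - fcoef f n).

Lemma fps_addA : associative fps_add.
Proof. by move=> f g h; apply: fpsP => n /=; rewrite addrA. Qed.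
Lemma fps_addC : commutative fps_add.
Proof. by move=> f g; apply: fpsP => n /=; rewrite addrC. Qed.
Lemma fps_add0 : left_id (Fps (fun=> 0)) fps_add.
Proof. by move=> f; apply: fpsP => n /=; rewrite add0r. Qed.
Lemma fps_addN : left_inverse (Fps (fun=> 0)) fps_opp fps_add.
Proof. by move=> f; apply: fpsP => n /=; rewrite addNr. Qed.

HB.instance Definition _ :=
  GRing.isZmodule.Build fps fps_addA fps_addC fps_add0 fps_addN.

Definition fps_one := Fps (fun n => (n == 0%N)%:R).
Definition fps_mul (f g : fps) :=
  Fps (fun n => \sum_(i < n.+1) fcoef f i * fcoef g (n - i)).

Definition fps_trunc N (f : fps) : {poly int} := \poly_(i < N) fcoef f i.

Lemma fps_mul_trunc N (f g : fps) n : (n < N)%N ->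
  fcoef (fps_mul f g) n = (fps_trunc N f * fps_trunc N g)`_n.
Proof.
move=> nN; rewrite coefM /=; apply: eq_bigr => -[i /= iSn] _.
by rewrite !coef_poly (leq_trans iSn nN) (leq_ltn_trans (leq_subr _ _) nN).
Qed.

Lemma fps_mulC : commutative fps_mul.
Proof.
by move=> f g; apply: fpsP => n; rewrite !(@fps_mul_trunc n.+1) // mulrC.
Qed.

Lemma fps_mulA : associative fps_mul.
Proof.
move=> f g h; apply: fpsP => n.
transitivity (fps_trunc n.+1 f * fps_trunc n.+1 g * fps_trunc n.+1 h)`_n.
  rewrite -mulrA coefM; apply: eq_bigr => -[i /= iSn] _.
  rewrite coef_poly iSn -(@fps_mul_trunc n.+1) //.
  exact: leq_ltn_trans (leq_subr _ _) _.
rewrite coefM; apply: eq_bigr => -[i /= iSn] _.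
rewrite coef_poly (leq_ltn_trans (leq_subr _ _)) //.
by rewrite -(@fps_mul_trunc n.+1).
Qed.

Lemma fps_mul1 : left_id fps_one fps_mul.
Proof.
move=> f; apply: fpsP => n /=; rewrite big_ord_recl /= subn0 mul1r.
by rewrite big1 ?addr0 // => i _; rewrite mul0r.
Qed.

Lemma fps_mulD : left_distributive fps_mul fps_add.
Proof.
move=> f g h; apply: fpsP => n /=; rewrite -big_split /=.
by apply: eq_bigr => i _; rewrite mulrDl.
Qed.

Lemma fps_one_neq0 : fps_one != 0.
Proof. by apply/eqP => /(congr1 (fun f => fcoef f 0)). Qed.

HB.instance Definition _ := GRing.Zmodule_isComNzRing.Build fps
  fps_mulA fps_mulC fps_mul1 fps_mulD fps_one_neq0.

Definition fps_unit : pred fps := fun f => fcoef f 0 \is a GRing.unit.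

(* The first [n] coefficients of the inverse of [f], obtained by solving
   [f * g = 1] for the successive coefficients of [g]. *)
Fixpoint inv_coefs (f : fps) (n : nat) : seq int :=
  if n is m.+1 then
    let s := inv_coefs f m in
    rcons s ((fcoef f 0)^-1 *
             ((m == 0%N)%:R - \sum_(i < m) s`_i * fcoef f (m - i)))
  else [::].

Definition fps_inv (f : fps) : fps :=
  if fps_unit f then Fps (fun n => (inv_coefs f n.+1)`_n) else f.

Lemma size_inv_coefs f n : size (inv_coefs f n) = n.
Proof. by elim: n => //= n IHn; rewrite size_rcons IHn. Qed.

Lemma nth_inv_coefs f n i : (i < n)%N ->
  (inv_coefs f n)`_i = (inv_coefs f i.+1)`_i.
Proof.
elim: n => // n IHn; rewrite ltnS leq_eqVlt => /predU1P[->//|lt_in].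
by rewrite [in LHS]/= nth_rcons size_inv_coefs lt_in IHn.
Qed.

Lemma fps_mulV : {in fps_unit, left_inverse 1 fps_inv *%R}.
Proof.
move=> f; rewrite unfold_in => uf; rewrite /fps_inv /fps_unit uf.
apply: fpsP => n.
have -> : fcoef (Fps (fun n => (inv_coefs f n.+1)`_n) * f) n =
    \sum_(i < n.+1) (inv_coefs f i.+1)`_i * fcoef f (n - i) by [].
rewrite big_ord_recr /= nth_rcons size_inv_coefs ltnn eqxx subnn.
rewrite [X in _ + X]mulrC mulVKr // addrC.
rewrite [X in _ + X](eq_bigr (fun i : 'I_n =>
  (inv_coefs f n)`_i * fcoef f (n - i))); first by rewrite subrK.
by move=> i _; rewrite [in RHS](@nth_inv_coefs f n i).
Qed.

Lemma fps_unitP (f g : fps) : g * f = 1 -> fps_unit f.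
Proof.
move=> /(congr1 (fun h => fcoef h 0)) /=; rewrite big_ord1 subnn => gf1.
by apply/unitrPr; exists (fcoef g 0); rewrite mulrC.
Qed.

Lemma fps_inv_out : {in [predC fps_unit], fps_inv =1 id}.
Proof.
by move=> f; rewrite inE /= /fps_inv => /negPf; rewrite -topredE /= => ->.
Qed.

HB.instance Definition _ := GRing.ComNzRing_hasMulInverse.Build fps
  fps_mulV fps_unitP fps_inv_out.

(* The indeterminate. *)
Definition fpsX : fps := Fps (fun n => (n == 1%N)%:R).
Notation "''q'" := fpsX : ring_scope.

(* The sum of an infinite family in the topology of coefficientwise convergence:
   each coefficient is the eventual value of that coefficient in the partial
   sums (and the junk value 0 if the partial sums do not stabilize). *)
Definition fps_sum (F : nat -> fps) : fps :=
  Fps (fun N => xget 0 [set c | exists M, forall m, (M <= m)%N ->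
                                  fcoef (\sum_(n < m) F n) N = c]%classic).

Lemma fcoef_sum (I : Type) (r : seq I) (P : pred I) (F : I -> fps) N :
  fcoef (\sum_(i <- r | P i) F i) N = \sum_(i <- r | P i) fcoef (F i) N.
Proof.
exact: (big_morph (fun f => fcoef f N) (fun _ _ => erefl) erefl).
Qed.

Lemma fcoef_fps_sum (F : nat -> fps) N M :
  (forall n, (M <= n)%N -> fcoef (F n) N = 0) ->
  fcoef (fps_sum F) N = \sum_(n < M) fcoef (F n) N.
Proof.
move=> F0; have stab m : (M <= m)%N ->
    fcoef (\sum_(n < m) F n) N = \sum_(n < M) fcoef (F n) N.
  move=> Mm; rewrite fcoef_sum -(subnKC Mm) big_split_ord /= [X in _ + X]big1.
    by rewrite addr0.
  by move=> i _; rewrite F0 // leq_addr.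
rewrite /fps_sum /=; case: xgetP => [c _ [M' cE]|/(_ (\sum_(n < M) fcoef (F n) N))].
  by rewrite -(cE (maxn M M')) ?stab // ?leq_maxl ?leq_maxr.
by case; exists M.
Qed.

Lemma fcoef_mulXn f k N :
  fcoef (f * 'q ^+ k) N = if (N < k)%N then 0 else fcoef f (N - k).
Proof.
elim: k N => [|k IHk] N; first by rewrite mulr1 subn0.
rewrite exprSr mulrA; move: (f * 'q ^+ k) IHk => g IHk.
have -> : fcoef (g * 'q) N =
    \sum_(i < N.+1) fcoef g i * (N - i == 1)%N%:R by [].
case: N => [|N]; first by rewrite big_ord1 mulr0.
rewrite 2!big_ord_recr [LHS]/= subnn subSnn mulr0 mulr1 addr0 IHk ltnS subSS.
rewrite big1 ?add0r // => i _.
by rewrite subSn 1?ltnW ?ltn_ord // eqSS subn_eq0 leqNgt ltn_ord mulr0.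
Qed.

(** * The series omega *)

(* [qpoch a b n] is the q-Pochhammer symbol (a; b)_n. *)
Definition qpoch (R : nzRingType) (a b : R) (n : nat) : R :=
  \prod_(j < n) (1 - a * b ^+ j).

Definition omega_term (n : nat) : fps :=
  'q ^+ (2 * n ^ 2 + 2 * n) / qpoch 'q ('q ^+ 2) n.+1 ^+ 2.

Definition omega : fps := fps_sum omega_term.

Lemma qpoch_unit n : qpoch 'q ('q ^+ 2) n \is a GRing.unit.
Proof.
apply: (big_ind (fun f : fps => f \is a GRing.unit)) => [|f g uf ug|j _].
- exact: unitr1.
- by rewrite unitrMl.
- rewrite -exprM -exprS -['q ^+ _]mul1r.
  change (fps_unit (1 - 1 * 'q ^+ (2 * j).+1)); rewrite /fps_unit.
  change (1 - fcoef (1 * 'q ^+ (2 * j).+1) 0 \is a GRing.unit).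
  by rewrite fcoef_mulXn /= subr0 unitr1.
Qed.

Lemma fcoef_omega N : fcoef omega N = \sum_(n < N.+1) fcoef (omega_term n) N.
Proof.
apply: fcoef_fps_sum => n lt_Nn; rewrite /omega_term mulrC fcoef_mulXn.
suff -> : (N < 2 * n ^ 2 + 2 * n)%N by [].
by rewrite (leq_trans lt_Nn) // (leq_trans _ (leq_addl _ _)) // leq_pmull.
Qed.

(** * Two-color partitions *)

Definition color : finType := bool.
Definition blue : color := true.
Definition green : color := false.

(* A two-color partition of [n] is given by its multiplicities: [p (k, c)] is
   the number of parts equal to [k] of color [c]. Neither the parts nor the
   multiplicities of a partition of [n] exceed [n]. *)
Definition colored_mult (n : nat) := {ffun 'I_n.+1 * color -> 'I_n.+1}.

Definition is_partition2 (n : nat) (p : colored_mult n) : bool :=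
  [forall c : color, p (ord0, c) == 0%N :> nat] &&
  (\sum_(x : 'I_n.+1 * color) x.1 * p x == n)%N.

Definition is_part (n : nat) (p : colored_mult n) (k : 'I_n.+1) : bool :=
  [exists c : color, 0 < p (k, c)]%N.

Definition is_smallest_part (n : nat) (p : colored_mult n) (s : 'I_n.+1) :
    bool :=
  is_part p s && [forall k, is_part p k ==> (s <= k)%N].

Definition omega_admissible (n : nat) (p : colored_mult n) : bool :=
  [&& [forall k : 'I_n.+1, ~~ odd k ==> (p (k, green) == 0%N :> nat)],
      [forall k : 'I_n.+1, ~~ odd k ==> (p (k, blue) <= 1)%N] &
      [exists s, [&& is_smallest_part p s, odd s & (0 < p (s, blue))%N]]].

Definition num_even_parts (n : nat) (p : colored_mult n) : nat :=
  (\sum_(x : 'I_n.+1 * color | ~~ odd x.1) p x)%N.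

Definition T_omega (n : nat) : int :=
  \sum_(p : colored_mult n | is_partition2 p && omega_admissible p)
     (-1) ^+ num_even_parts p.

(* Main.v *)
Require Import Defs.
From mathcomp Require Import all_boot all_order all_algebra.
From mathcomp Require Import ring zify.

Set Implicit Arguments.
Unset Strict Implicit.
Unset Printing Implicit Defensive.

Import GRing.Theory.
Local Open Scope ring_scope.

(** Put Q = q^2, x_k = q^(2k+1) and
    G_k = sum_n Q^n (Q^(n+1); Q)_oo / (x_k Q^n; Q)_oo^2.
    Since x_(k+1) = x_k Q, the summands of (1 - x_k)^2 G_k - x_k^2 Q G_(k+1)
    telescope: they are the differences of
    v_n = (Q^n; Q)_oo (1 - x_k^2 Q^n) / (x_k Q^n; Q)_oo^2, where v_0 = 0 and v_n
    tends to 1. Hence (1 - x_k)^2 G_k = 1 + q^(4k+4) G_(k+1), and iterating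
    from k = 0 produces the terms of omega one after the other. On the other
    hand, q G_0 is the generating function of T_omega: sort the partitions by
    their smallest part 2n+1.
    The infinite products are replaced by finite ones, and the identities by
    congruences modulo a power of q. *)

(** * Congruence of power series modulo q^N *)

Definition eqm (N : nat) (f g : fps) : Prop :=
  forall i, (i < N)%N -> fcoef f i = fcoef g i.

Lemma eqm_refl N f : eqm N f f. Proof. by []. Qed.

Lemma eqm_sym N f g : eqm N f g -> eqm N g f.
Proof. by move=> fg i iN; rewrite fg. Qed.

Lemma eqm_trans N g f h : eqm N f g -> eqm N g h -> eqm N f h.
Proof. by move=> fg gh i iN; rewrite fg // gh. Qed.

Lemma eqmD N f f' g g' : eqm N f f' -> eqm N g g' -> eqm N (f + g) (f' + g').
Proof. by move=> ff gg i iN; congr (_ + _); [apply: ff|apply: gg]. Qed.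

Lemma eqmN N f f' : eqm N f f' -> eqm N (- f) (- f').
Proof. by move=> ff i iN; congr (- _); apply: ff. Qed.

Lemma eqmM N f f' g g' : eqm N f f' -> eqm N g g' -> eqm N (f * g) (f' * g').
Proof.
move=> ff gg i iN; apply: eq_bigr => -[j /= ji] _.
congr (_ * _); [apply: ff|apply: gg]; apply: leq_ltn_trans iN => //.
exact: leq_subr.
Qed.

Lemma eqm_sum N (I : Type) (r : seq I) (P : pred I) (F G : I -> fps) :
  (forall i, P i -> eqm N (F i) (G i)) ->
  eqm N (\sum_(i <- r | P i) F i) (\sum_(i <- r | P i) G i).
Proof.
move=> FG; apply: (big_ind2 (eqm N)) => // f f' g g'; exact: eqmD.
Qed.

Lemma eqm_prod N (I : Type) (r : seq I) (P : pred I) (F G : I -> fps) :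
  (forall i, P i -> eqm N (F i) (G i)) ->
  eqm N (\prod_(i <- r | P i) F i) (\prod_(i <- r | P i) G i).
Proof.
move=> FG; apply: (big_ind2 (eqm N)) => // f f' g g'; exact: eqmM.
Qed.

Lemma eqm_prod1 N (I : Type) (r : seq I) (P : pred I) (F : I -> fps) :
  (forall i, P i -> eqm N (F i) 1) -> eqm N (\prod_(i <- r | P i) F i) 1.
Proof.
move=> F1; apply: (big_ind (eqm N ^~ 1)) => // f g f1 g1.
by rewrite -[1]mulr1; apply: eqmM.
Qed.

Lemma eqm_mulXn0 N k f : (N <= k)%N -> eqm N (f * 'q ^+ k) 0.
Proof. by move=> Nk i iN; rewrite fcoef_mulXn (leq_trans iN Nk). Qed.

Lemma eqm_Xn0 N k : (N <= k)%N -> eqm N ('q ^+ k) 0.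
Proof. by move=> Nk; rewrite -['q ^+ k]mul1r; apply: eqm_mulXn0. Qed.

Lemma eqm_subXn N k f : (N <= k)%N -> eqm N (f - 'q ^+ k) f.
Proof.
move=> Nk; rewrite -[X in eqm N _ X]subr0.
by apply: eqmD => //; apply/eqmN/eqm_Xn0.
Qed.

Lemma eqmV1 N f : f \is a GRing.unit -> eqm N f 1 -> eqm N f^-1 1.
Proof.
move=> uf f1; rewrite -(mulVr uf) -[X in eqm N X]mulr1.
by apply: eqmM => //; apply: eqm_sym.
Qed.

Lemma subXn_unit k : (0 < k)%N -> 1 - 'q ^+ k \is a GRing.unit.
Proof.
case: k => // k _; change (fps_unit (1 - 'q ^+ k.+1)); rewrite /fps_unit.
change (1 - fcoef ('q ^+ k.+1) 0 \is a GRing.unit).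
by rewrite -['q ^+ _]mul1r fcoef_mulXn subr0 unitr1.
Qed.

Lemma fcoef_intr z N : fcoef z%:~R N = z * (N == 0%N)%:R.
Proof.
have H (m : nat) : fcoef (m%:R) N = m%:R * (N == 0%N)%:R.
  elim: m => [|m IHm]; first by rewrite mul0r.
  by rewrite -addn1 !natrD mulrDl mul1r -IHm.
case: z => m; first by rewrite -pmulrn H natz.
rewrite NegzE mulrNz -pmulrn mulNr.
by change (- fcoef (m.+1%:R) N = - (m.+1%:Z * (N == 0)%:R)); rewrite H natz.
Qed.

Lemma fcoef_intrXn z k N : fcoef (z%:~R * 'q ^+ k) N = z * (N == k)%:R.
Proof.
rewrite fcoef_mulXn fcoef_intr; case: ltngtP => [_|kN|->].
- by rewrite mulr0.
- by rewrite subn_eq0 leqNgt kN.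
- by rewrite subnn.
Qed.

(** * Truncations of G_k and their recurrence *)

Definition even_prod (M n : nat) : fps :=
  \prod_(n <= j < M) (1 - 'q ^+ (2 * j)).

(** With Q and x_m as above, [even_prod M n] truncates (Q^n; Q)_oo and [odd_prod L m] truncates 1 /
    (x_m; Q)_oo^2. *)
Definition odd_prod (L m : nat) : fps :=
  \prod_(m <= j < L) (1 - 'q ^+ (2 * j + 1)) ^- 2.

Lemma even_prodS M n : (n < M)%N ->
  even_prod M n = (1 - 'q ^+ (2 * n)) * even_prod M n.+1.
Proof. by move=> nM; rewrite /even_prod big_ltn. Qed.

Lemma odd_prodS L m : (m < L)%N ->
  odd_prod L m.+1 = (1 - 'q ^+ (2 * m + 1)) ^+ 2 * odd_prod L m.
Proof.
move=> mL; rewrite /odd_prod [in RHS]big_ltn // mulVKr //.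
by rewrite unitrX // subXn_unit ?addn1.
Qed.

(* [Gsum M k] is a truncation of G_k; its odd products run to [2 * M] so that
   those of [Gsum M k.+1] are exact shifts for all [k <= M]. *)
Definition Gsum (M k : nat) : fps :=
  \sum_(0 <= n < M) 'q ^+ (2 * n) * even_prod M n.+1 * odd_prod (2 * M) (n + k).

(** The telescoping is exact for the truncations; the end value [v M] stands in place of the limit
    1. *)
Lemma Gsum_rec M k : (0 < M)%N -> (k <= M)%N ->
  (1 - 'q ^+ (2 * k + 1)) ^+ 2 * Gsum M k =
  (1 - 'q ^+ (4 * k + 2 + 2 * M)) * odd_prod (2 * M) (M + k)
  + 'q ^+ (4 * k + 4) * Gsum M k.+1.
Proof.
move=> M0 kM; apply/eqP; rewrite -subr_eq; apply/eqP.
pose v n :=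
  even_prod M n * (1 - 'q ^+ (4 * k + 2 + 2 * n)) * odd_prod (2 * M) (n + k).
have -> : (1 - 'q ^+ (4 * k + 2 + 2 * M)) * odd_prod (2 * M) (M + k) =
         v M - v 0%N.
  rewrite /v [even_prod M 0]even_prodS // muln0 expr0 subrr !mul0r subr0.
  by rewrite /even_prod big_geq // mul1r.
rewrite -(telescope_sumr v) // !mulr_sumr -sumrB; apply: eq_big_nat => n /= nM.
rewrite /v (even_prodS nM) (addnS n k) addSn odd_prodS; last by lia.
(* Exponents are split into [2 * k], [2 * n] and constants, so that after [exprD] only a polynomial
   identity in these powers of q is left. *)
rewrite (_ : 4 * k + 2 + 2 * n.+1 = 2 * k + 2 * k + 2 * n + 4)%N; last by lia.
rewrite (_ : 4 * k + 2 + 2 * n = 2 * k + 2 * k + 2 * n + 2)%N; last by lia.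
rewrite (_ : 4 * k + 4 = 2 * k + 2 * k + 4)%N; last by lia.
rewrite (_ : 2 * (n + k) + 1 = 2 * n + 2 * k + 1)%N; last by lia.
rewrite !exprD; ring.
Qed.

(** * Iterating the recurrence to reach omega *)

Lemma qpochS k :
  qpoch 'q ('q ^+ 2) k.+1 = qpoch 'q ('q ^+ 2) k * (1 - 'q ^+ (2 * k + 1)).
Proof. by rewrite /qpoch big_ord_recr /= -exprM -exprS addn1. Qed.

Lemma eqm_odd_prod1 N L m : (N <= 2 * m + 1)%N -> eqm N (odd_prod L m) 1.
Proof.
move=> Nm; rewrite /odd_prod big_nat; apply: eqm_prod1 => j /andP[mj _].
have j1 : eqm N (1 - 'q ^+ (2 * j + 1)) 1 by apply: eqm_subXn; lia.
apply: eqmV1; first by rewrite unitrX // subXn_unit ?addn1.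
by rewrite expr2 -[X in eqm N _ X]mulr1; apply: eqmM.
Qed.

(** Each use of [Gsum_rec] splits off one term of omega. The exponents 4k+4 for k < K add up to
    2K^2+2K, so after [M] uses the remainder vanishes modulo q^(2M). *)
Lemma Gsum_omega M : (0 < M)%N ->
  eqm (2 * M) (Gsum M 0) (\sum_(k < M) omega_term k).
Proof.
move=> M0.
suff partial K : (K <= M)%N -> eqm (2 * M) (Gsum M 0)
    (\sum_(k < K) omega_term k +
     Gsum M K / qpoch 'q ('q ^+ 2) K ^+ 2 * 'q ^+ (2 * K ^ 2 + 2 * K)).
  apply: eqm_trans (partial M (leqnn M)) _; rewrite -[X in eqm _ _ X]addr0.
  by apply: eqmD => //; apply: eqm_mulXn0; lia.
elim: K => [|K IHK] KM.
  by rewrite big_ord0 add0r expr0 mulr1 /qpoch big_ord0 expr1n divr1.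
apply: eqm_trans (IHK (ltnW KM)) _.
have u : 1 - 'q ^+ (2 * K + 1) \is a GRing.unit by rewrite subXn_unit ?addn1.
have uq := qpoch_unit K.
rewrite big_ord_recr /= -addrA; apply: eqmD => //.
pose A := (1 - 'q ^+ (2 * K + 1)) ^- 2 / qpoch 'q ('q ^+ 2) K ^+ 2.
pose e := 'q ^+ (2 * K ^ 2 + 2 * K).
have -> : Gsum M K / qpoch 'q ('q ^+ 2) K ^+ 2 * e =
   ((1 - 'q ^+ (4 * K + 2 + 2 * M)) * odd_prod (2 * M) (M + K)
    + 'q ^+ (4 * K + 4) * Gsum M K.+1) * (A * e).
  rewrite -Gsum_rec ?(ltnW KM) // mulrACA mulrCA.
  by rewrite /A mulrA mulVKr ?mulrV ?unitrX // mul1r.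
have -> : omega_term K + Gsum M K.+1 / qpoch 'q ('q ^+ 2) K.+1 ^+ 2
     * 'q ^+ (2 * K.+1 ^ 2 + 2 * K.+1) =
   (1 + 'q ^+ (4 * K + 4) * Gsum M K.+1) * (A * e).
  rewrite /omega_term qpochS exprMn invrM ?unitrX // -/A -/e.
  rewrite (_ : 2 * K.+1 ^ 2 + 2 * K.+1 = (2 * K ^ 2 + 2 * K) + (4 * K + 4))%N;
    last by lia.
  by rewrite exprD -/e; ring.
(* The end value in [Gsum_rec] is 1 at this precision: both of its factors differ from 1 only in
   degrees at least 2M. *)
apply: eqmM => //; apply: eqmD => //; rewrite -[X in eqm _ _ X]mulr1.
apply: eqmM; last by apply: eqm_odd_prod1; lia.
by apply: eqm_subXn; lia.
Qed.

(** * Partitions sorted by their smallest part *)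

(* [allowed s x j]: [j] copies of the part [x] may occur in an admissible
   partition with smallest part [s]. *)
Definition allowed n (s : 'I_n.+1) (x : 'I_n.+1 * color) : pred 'I_n.+1 :=
  fun j => [&& (x.1 < s)%N ==> (j == 0 :> nat)%N,
    (x == (s, blue)) ==> (0 < j)%N &
    ~~ odd x.1 ==> if x.2 then (j <= 1)%N else (j == 0 :> nat)%N].

(** Once [s] is fixed, the conditions on the multiplicities are independent of each other, as
    expanding a product of sums requires. The part 0 is excluded because an odd [s] is positive. *)
Lemma admissibleE n (p : colored_mult n) :
  [forall c : color, p (ord0, c) == 0%N :> nat] && omega_admissible p =
  [exists s : 'I_n.+1, odd s && (p \in family (allowed s))].
Proof.
apply/andP/existsP.
- case=> /forallP p0 /and3P[/forallP gr /forallP bl] /existsP[s].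
  case/and3P => /andP[_ /forallP smin] os sb; exists s; rewrite os /=.
  apply/familyP => -[k c]; rewrite unfold_in /=; apply/and3P; split.
  + apply/implyP => ks; rewrite -leqn0 leqNgt; apply/negP => pk.
    have := smin k; rewrite leqNgt ks implybF => /negP; apply.
    by apply/existsP; exists c.
  + by apply/implyP => /eqP[-> ->].
  + by apply/implyP => ek; case: c;
       [apply: (implyP (bl k))|apply: (implyP (gr k))].
- case=> s /andP[os /familyP ps].
  have {}ps k c : allowed s (k, c) (p (k, c)) := ps (k, c).
  have s0 : (0 < s)%N by case: (nat_of_ord s) os.
  split.
    by apply/forallP => c; case/and3P: (ps ord0 c) => /= /implyP/(_ s0).
  apply/and3P; split.
  + by apply/forallP => k; case/and3P: (ps k green).
  + by apply/forallP => k; case/and3P: (ps k blue).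
  + have sb : (0 < p (s, blue))%N by case/and3P: (ps s blue) => _ /implyP->.
    apply/existsP; exists s; rewrite os sb !andbT.
    apply/andP; split; first by apply/existsP; exists blue.
    apply/forallP => k; apply/implyP => /existsP[c pk].
    rewrite leqNgt; apply/negP => ks.
    by case/and3P: (ps k c) => /implyP/(_ ks)/eqP p0; rewrite p0 in pk.
Qed.

(** Otherwise the smaller of [s] and [t] would occur in blue and yet be forbidden as lying below the
    other. So no partition is counted twice. *)
Lemma allowed_inj n (p : colored_mult n) s t :
  p \in family (allowed s) -> p \in family (allowed t) -> s = t.
Proof.
wlog st : s t / (s <= t)%N => [H ps pt|].
  by case: (leqP s t) => [/H->//|/ltnW /H<-].
move=> /familyP/(_ (s, blue))/and3P[_ /implyP/(_ (eqxx _)) sb _].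
move=> /familyP/(_ (s, blue))/and3P[/= /implyP sz _ _].
move: st; rewrite leq_eqVlt => /predU1P[/val_inj//|/sz/eqP p0].
by rewrite p0 in sb.
Qed.

Definition part_weight n (x : 'I_n.+1 * color) (j : 'I_n.+1) : fps :=
  (-1) ^+ (if ~~ odd x.1 then j : nat else 0%N) * 'q ^+ (x.1 * j).

Lemma T_omegaE n : T_omega n =
  fcoef (\sum_(s < n.+1 | odd s)
           \prod_x \sum_(j | allowed s x j) part_weight x j) n.
Proof.
(* Signs become integer constants, so that each expanded product is a monomial to which
   [fcoef_intrXn] applies. *)
have sgn k : (-1) ^+ k = ((-1) ^+ k)%:~R :> fps by rewrite rmorphXn rmorphN1.
have wE (p : colored_mult n) : \prod_x part_weight x (p x) =
    ((-1) ^+ num_even_parts p)%:~R *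
    'q ^+ (\sum_(x : 'I_n.+1 * color) x.1 * p x).
  by rewrite big_split /= !prodrXr sgn /num_even_parts [in RHS]big_mkcond.
rewrite fcoef_sum; under eq_bigr => s _.
  rewrite (bigA_distr_big_dep (allowed s)) fcoef_sum.
  under eq_bigr => p _.
    rewrite wE fcoef_intrXn.
    over.
  over.
(* For a fixed [p], the inner sum over [s] now has at most one term. *)
rewrite (exchange_big_dep predT) //= /T_omega big_mkcond; apply: eq_bigr => p _.
rewrite /is_partition2 andbAC admissibleE; case: existsP => [[s sP]|sN].
  rewrite (big_pred1 s) => [|t]; last first.
    apply/idP/eqP => [/andP[_ pt]|->//].
    by apply: allowed_inj pt _; case/andP: sP.
  by rewrite eq_sym /=; case: eqP; rewrite ?mulr1 ?mulr0.
by rewrite big_pred0 // => s; apply/negP => sP; apply: sN; exists s.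
Qed.

(** * Generating factors of the individual parts *)

Lemma eqm_geom N k : (0 < k)%N ->
  eqm N (\sum_(j < N) 'q ^+ (k * j)) (1 - 'q ^+ k)^-1.
Proof.
move=> k0; have u := subXn_unit k0.
have -> : \sum_(j < N) 'q ^+ (k * j) = (1 - 'q ^+ (k * N)) / (1 - 'q ^+ k).
  apply: (mulIr u); rewrite mulrVK // -[RHS]opprB exprM subrX1 -mulNr opprB.
  by rewrite mulrC; under eq_bigr do rewrite exprM.
rewrite -[X in eqm N _ X]mul1r; apply: eqmM => //.
by apply: eqm_subXn; rewrite leq_pmull.
Qed.

(** For odd [k], the square accounts for the two colors; for even [k], the part is blue, occurs at
    most once and carries a sign. *)
Definition part_factor (k : nat) : fps :=
  if odd k then (1 - 'q ^+ k) ^- 2 else 1 - 'q ^+ k.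

Lemma sum_allowed_eqm n (s k : 'I_n.+1) (c : color) : (0 < n)%N -> odd s ->
  eqm n.+1 (\sum_(j | allowed s (k, c) j) part_weight (k, c) j)
    (if (k < s)%N then 1 else
     if odd k then (if (k == s) && c then 'q ^+ s else 1) / (1 - 'q ^+ k)
     else if c then 1 - 'q ^+ k else 1).
Proof.
move=> n0 os; rewrite /allowed /part_weight /=.
have s0 : (0 < s)%N by case: (nat_of_ord s) os.
case: ltnP => [ks|sk].
  have kNs : (k == s) = false by apply/eqP => E; rewrite E ltnn in ks.
  rewrite (big_pred1 ord0) => [|j].
    by rewrite /= muln0 if_same !expr0 mul1r.
  rewrite xpair_eqE kNs /= -val_eqE /=.
  by case: (nat_of_ord j) => [|i]; case: (odd k); case: (c); rewrite ?andbF.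
have k0 : (0 < k)%N := leq_trans s0 sk.
have [ok|ek] := boolP (odd k); rewrite /=.
  under eq_bigr do rewrite expr0 mul1r.
  rewrite xpair_eqE; case: ifP => [/andP[/eqP-> cT]|kcF].
    (* The blue smallest part occurs at least once: its geometric series loses the constant term. *)
    have -> : 'q ^+ s / (1 - 'q ^+ s) = (1 - 'q ^+ s)^-1 - 1.
      apply: (mulIr (subXn_unit s0)).
      by rewrite mulrBl mulrVK ?mulVr ?subXn_unit // mul1r opprB addrC subrK.
    rewrite (eq_bigl (fun j : 'I_n.+1 => j != ord0)) => [|j].
      apply: eqm_trans (_ : eqm _ (\sum_(j < n.+1) 'q ^+ (s * j) - 1) _).
        rewrite [X in eqm _ _ (X - 1)](bigD1 ord0) //= muln0 expr0 addrC addrK.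
        exact: eqm_refl.
      by apply: eqmD => //; apply: eqm_geom.
    by rewrite cT eqxx /= andbT lt0n.
  rewrite mul1r (eq_bigl xpredT); first exact: eqm_geom.
  by move=> j; move: kcF; rewrite /blue; case: (k == s) (c) => -[].
have kNs : (k == s) = false by apply/eqP => E; rewrite E os in ek.
rewrite xpair_eqE kNs /=; case: c.
  (* A blue even part has multiplicity 0 or 1; [n0] makes 1 an element of ['I_n.+1]. *)
  rewrite (bigD1 ord0) //= (bigD1 (Ordinal (n0 : 1 < n.+1)%N)) //=.
  rewrite big1 => [|[[|[|j]] jn]] //.
  by rewrite muln0 muln1 !expr0 expr1 mul1r addr0 mulN1r.
by rewrite (big_pred1 ord0) => [|j] //; rewrite muln0 !expr0 mul1r.
Qed.

Lemma prod_allowed_eqm n (s : 'I_n.+1) : (0 < n)%N -> odd s ->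
  eqm n.+1 (\prod_x \sum_(j | allowed s x j) part_weight x j)
    ('q ^+ s * \prod_(s <= k < n.+1) part_factor k).
Proof.
move=> n0 os.
rewrite (eq_bigr (fun x => \sum_(j | allowed s (x.1, x.2) j)
                             part_weight (x.1, x.2) j)); last by case.
rewrite -(pair_bigA _ (fun k c => \sum_(j | allowed s (k, c) j)
                             part_weight (k, c) j)) /=.
under eq_bigr do rewrite big_bool.
(* The target is spread over all [k], with ['q ^+ s] placed at [k = s], to allow a comparison factor
   by factor. *)
have -> : 'q ^+ s * \prod_(s <= k < n.+1) part_factor k =
    \prod_(k < n.+1) ((if k == s then 'q ^+ s else 1) *
                      (if (s <= k)%N then part_factor k else 1)).
  rewrite big_split -big_mkcond big_pred1_eq; congr (_ * _).
  rewrite -[RHS](big_mkord (fun=> true)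
                  (fun k => if (s <= k)%N then part_factor k else 1)).
  rewrite [RHS](@big_cat_nat _ _ _ s) //=; last exact: ltnW.
  rewrite [X in _ = X * _]big1_seq ?mul1r.
    by apply: eq_big_nat => k /andP[->].
  move=> k /andP[_]; rewrite mem_index_iota => /andP[_ ks].
  by rewrite leqNgt ks.
apply: eqm_prod => k _.
have bl := @sum_allowed_eqm n s k true n0 os.
have gr := @sum_allowed_eqm n s k false n0 os.
apply: eqm_trans (eqmM bl gr) _; rewrite andbT andbF /part_factor.
case: ltnP => [ks|sk].
  have -> : (k == s) = false by apply/eqP => E; rewrite E ltnn in ks.
  by rewrite mulr1.
have [ok|ek] := boolP (odd k); first by rewrite mul1r -exprVn expr2 mulrA.
have -> : (k == s) = false by apply/eqP => E; rewrite E os in ek.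
by rewrite mul1r mulr1.
Qed.

(** * Identification with q G_0 *)

Lemma prod_part_factor M i : (i < M)%N ->
  \prod_(2 * i + 1 <= k < 2 * M) part_factor k =
  even_prod M i.+1 * odd_prod M i.
Proof.
have oE j : part_factor (2 * j + 1) = (1 - 'q ^+ (2 * j + 1)) ^- 2.
  by rewrite /part_factor mul2n addn1 /= odd_double.
have eE j : part_factor (2 * j) = 1 - 'q ^+ (2 * j).
  by rewrite /part_factor mul2n odd_double.
(* Each step adds the factors of 2M and 2M+1; for [i = M] only the latter is in range. *)
elim: M => // M IHM; rewrite ltnS leq_eqVlt => /predU1P[->|iM].
  rewrite [even_prod _ _]big_geq // mul1r /odd_prod.
  by rewrite (_ : 2 * M.+1 = (2 * M + 1).+1)%N ?big_nat1 ?oE //; lia.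
rewrite (_ : 2 * M.+1 = (2 * M + 1).+1)%N; last by lia.
rewrite big_nat_recr /=; last by lia.
rewrite oE (addn1 (2 * M)) big_nat_recr /=; last by lia.
rewrite IHM // eE /even_prod /odd_prod !big_nat_recr //=; last exact: ltnW.
by rewrite (addn1 (2 * M)) -!mulrA; congr (_ * _); rewrite mulrCA.
Qed.

Lemma sum_odd (F : nat -> fps) M :
  \sum_(0 <= s < 2 * M | odd s) F s = \sum_(0 <= i < M) F (2 * i + 1)%N.
Proof.
elim: M => [|M IHM]; first by rewrite muln0 !big_geq.
rewrite (_ : 2 * M.+1 = (2 * M).+2)%N; last by lia.
rewrite big_mkcond 2?big_nat_recr //= -big_mkcond IHM.
rewrite [RHS]big_nat_recr //= addn1.
by rewrite mul2n odd_double /= addr0.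
Qed.

Lemma T_omega_Gsum n : T_omega n.+1 = fcoef ('q * Gsum n.+1 0) n.+1.
Proof.
rewrite T_omegaE.
set M := n.+1; have lM : (M.+1 <= 2 * M)%N by rewrite /M; lia.
pose g s := 'q ^+ s * \prod_(s <= k < 2 * M) part_factor k.
have tail1 : eqm M.+1 (\prod_(M.+1 <= k < 2 * M) part_factor k) 1.
  rewrite big_nat; apply: eqm_prod1 => k /andP[Mk _]; rewrite /part_factor.
  have k1 : eqm M.+1 (1 - 'q ^+ k) 1 by apply: eqm_subXn.
  case: ifP => // _; apply: eqmV1.
    by rewrite unitrX // subXn_unit //; apply: leq_trans Mk.
  by rewrite expr2 -[X in eqm _ _ X]mulr1; apply: eqmM.
(* Raising the bounds to 2M is harmless: a smallest part [s] above [M] brings in ['q ^+ s], and the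
   extra factors are 1 by [tail1]. *)
have step1 : eqm M.+1
    (\sum_(s < M.+1 | odd s) \prod_x \sum_(j | allowed s x j) part_weight x j)
    (\sum_(0 <= s < 2 * M | odd s) g s).
  rewrite (@big_cat_nat _ _ _ M.+1) //= -[X in eqm _ X _]addr0.
  apply: eqmD; last first.
    apply: eqm_sym; rewrite big_nat_cond.
    apply: (big_ind (eqm M.+1 ^~ 0)) => // [f h f0 h0|s /andP[/andP[Ms _] _]].
      by rewrite -[0]addr0; apply: eqmD.
    by rewrite /g mulrC; apply: eqm_mulXn0.
  rewrite big_mkord; apply: eqm_sum => s os.
  apply: eqm_trans (prod_allowed_eqm _ os) _ => //.
  apply: eqmM => //; rewrite [X in eqm _ _ X](@big_cat_nat _ _ _ M.+1) //=.
    rewrite -[X in eqm _ X _]mulr1; apply: eqmM => //; exact: eqm_sym.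
  exact: ltnW.
rewrite (step1 M) // sum_odd /Gsum mulr_sumr.
rewrite [X in fcoef X](eq_big_nat _ _ (F2 := fun i =>
  'q ^+ (2 * i + 1) * (even_prod M i.+1 * odd_prod M i))); last first.
  by move=> i /= iM; rewrite /g prod_part_factor.
rewrite 2!big_mkord.
apply: (@eqm_sum M.+1) => // i _; rewrite addn0 !mulrA -exprS addn1.
(* [Gsum] has odd factors up to [2 * M] instead of [M]; the extra ones start at exponent 2M+1 and
   are 1 modulo q^(M+1). *)
apply: eqmM => //; rewrite /odd_prod [X in eqm _ _ X](@big_cat_nat _ _ _ M) //=.
  rewrite -[X in eqm _ X _]mulr1; apply: eqmM => //; apply: eqm_sym.
  by apply: (@eqm_odd_prod1 _ (2 * M) M); lia.
  by rewrite ltnW.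
by lia.
Qed.

Theorem theorem2 :
  fps_sum (fun n : nat => (T_omega n.+1)%:~R * 'q ^+ n.+1) = 'q * omega.
Proof.
(* The shift of the index makes [N] terms enough: from [n = N] on, the exponent [n.+1] exceeds
   [N]. *)
apply: fpsP => N; rewrite (@fcoef_fps_sum _ N N) => [|n Nn]; last first.
  by rewrite fcoef_intrXn; case: eqP => [E|]; [lia|rewrite mulr0].
under eq_bigr do rewrite fcoef_intrXn.
rewrite mulrC -['q in RHS]expr1 fcoef_mulXn.
case: N => [|n]; first by rewrite big_ord0.
rewrite fcoef_omega subn1 big_ord_recr /= eqxx mulr1 big1 => [|i _]; last first.
  by rewrite eqSS gtn_eqF ?mulr0.
rewrite add0r T_omega_Gsum mulrC -['q]expr1 fcoef_mulXn subn1 /=.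
(* The congruence modulo q^(2(n+1)) covers the degree [n] that remains after removing the factor
   q. *)
by rewrite Gsum_omega ?fcoef_sum //; lia.
Qed.
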